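(* Let $q$ be an odd prime and let $D_{2q}$ be the dihedral group of order $2q$. Then $C_{\mathrm{char}}(D_{2q})=\{2\}$ and $C_{\mathrm{comm}}(D_{2q})=\{q\}$.
   Context: For an integer lattice $M\subseteq\mathbb{Z}^N$, its conductor is the set of primes $p$ with $\operatorname{rank}_{\mathbb{F}_p}(M\bmod p)<\operatorname{rank}_{\mathbb{Q}}M$, where $M\bmod p$ is the image of $M$ in $\mathbb{F}_p^N$. Commuting conductor $C_{\mathrm{comm}}(G)$ of a finite group $G$: let $P$ be the $G\times G$ zero-one matrix with $P_{g,h}=1$ if $gh=hg$ and $0$ otherwise; $C_{\mathrm{comm}}(G)$ is the conductor of the $\mathbb{Z}$-span in $\mathbb{Z}^G$ of all row differences $P_g-P_{g'}$, $g,g'\in G$. Character conductor $C_{\mathrm{char}}(G)$: for $\chi\in\operatorname{Irr}(G)$ (irreducible complex characters) let $$\operatorname{OrbTr}(\chi)(c)=\sum_{\psi\in\operatorname{Gal}(\overline{\mathbb{Q}}/\mathbb{Q})\cdot\chi}\psi(c),$$ the sum over the distinct characters in the Galois orbit of $\chi$, for each conjugacy class $c$ of $G$. $C_{\mathrm{char}}(G)$ is the conductor of the $\mathbb{Z}$-span of all differences $\operatorname{OrbTr}(\chi)-\operatorname{OrbTr}(\chi')$, $\chi,\chi'\in\operatorname{Irr}(G)$, viewed as integer vectors indexed by the conjugacy classes of $G$. *)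

(* Defs.v *)
From HB Require Import structures.
From mathcomp Require Import all_boot all_order all_fingroup all_algebra.
From mathcomp Require Import all_solvable all_field all_character.
From mathcomp Require Import boolp.

Set Implicit Arguments.
Unset Strict Implicit.
Unset Printing Implicit Defensive.

Import GroupScope Order.TTheory GRing.Theory Num.Theory.
Local Open Scope ring_scope.

Section Conductor.

Variable I : finType.

Definition zspan (J : finType) (v : J -> {ffun I -> int}) :
    {ffun I -> int} -> Prop :=
  fun x => exists a : J -> int, x = \sum_j v j *~ a j.

Definition ffun_red (F : fieldType) (x : {ffun I -> int}) : {ffun I -> F^o} :=
  [ffun i => (x i)%:~R].

(* The dimension over F of the F-span of the image of M in F^I, as the largest
   number of elements of M with F-linearly independent images. For F = rat this
   is the rank of M; for F = 'F_p it is the rank of M mod p. *)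
Definition lattice_rank (F : fieldType) (M : {ffun I -> int} -> Prop) : nat :=
  \max_(r < #|I|.+1 | `[< exists s : r.-tuple {ffun I -> int},
                           (forall x, x \in s -> M x) /\
                           free (map (ffun_red F) s) >]) r.

Definition conductor (M : {ffun I -> int} -> Prop) : nat_pred :=
  [pred p | prime p && (lattice_rank 'F_p M < lattice_rank rat M)%N].

End Conductor.

Section GroupConductors.

Variables (gT : finGroupType) (G : {group gT}).

Definition commuting_row (g : subg_of G) : {ffun subg_of G -> int} :=
  [ffun h => ((g * h == h * g)%g)%:R].

Definition commuting_conductor : nat_pred :=
  conductor (zspan (fun gg : subg_of G * subg_of G =>
                      commuting_row gg.1 - commuting_row gg.2)).

(* Characters take values in algC, the algebraic closure of the rationals,
   whose ring endomorphisms are all automorphisms. *)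
Definition galois_orbit (i : Iirr G) : {set Iirr G} :=
  [set j | `[< exists u : {rmorphism algC -> algC},
                'chi_j = cfAut u 'chi_i >]].

Definition orbit_trace (i : Iirr G) : 'CF(G) :=
  \sum_(j in galois_orbit i) 'chi_j.

Lemma cfAut_orbit_trace (u : {rmorphism algC -> algC}) i :
  cfAut u (orbit_trace i) = orbit_trace i.
Proof.
have sub : aut_Iirr u @: galois_orbit i \subset galois_orbit i.
  apply/subsetP=> _ /imsetP[j /[!inE] /asboolP[w Dj] ->].
  apply/asboolP; exists (u \o w : {rmorphism algC -> algC}).
  by rewrite aut_IirrE Dj; apply/cfunP=> x; rewrite !cfunE.
have /eqP Eorb : aut_Iirr u @: galois_orbit i == galois_orbit i.
  by rewrite eqEcard sub (card_imset _ (@aut_Iirr_inj _ G u)) leqnn.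
rewrite /orbit_trace -{2}Eorb big_imset /=; last by move=> j k _ _; apply: aut_Iirr_inj.
by rewrite rmorph_sum; apply: eq_bigr => j _; rewrite aut_IirrE.
Qed.

Lemma orbit_trace_int i x : orbit_trace i x \in Num.int.
Proof.
have chT : orbit_trace i \is a character.
  by apply: rpred_sum => j _; apply: irr_char.
have [Gx|/cfun0->] := boolP (x \in G); last exact: rpred0.
apply: Cint_rat_Aint; last exact: Aint_char.
have [Qn galQn [QnC ext [w _ values]]] := group_num_field_exists G.
have [a Da] := values _ _ _ chT x (order_dvdG Gx).
have : a \in 1%VS.
  have /galois_fixedField <- := galQn.
  apply/fixedFieldP=> [|nuQn Gnu]; first exact: memvf.
  have [nu Dnu] := ext nuQn; apply: (fmorph_inj QnC).
  by rewrite Dnu Da -{2}(cfAut_orbit_trace nu) cfunE.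
by case/vlineP=> b Db; rewrite -Da Db alg_num_field fmorph_rat Crat_rat.
Qed.

(* By orbit_trace_int the floor only casts from algC to int. *)
Definition orbit_trace_vec (i : Iirr G) :
    {ffun {c : {set gT} | c \in classes G} -> int} :=
  [ffun c => Num.floor (orbit_trace i (repr (val c)))].

Definition character_conductor : nat_pred :=
  conductor (zspan (fun ij : Iirr G * Iirr G =>
                      orbit_trace_vec ij.1 - orbit_trace_vec ij.2)).

End GroupConductors.

(* Main.v *)
Require Import Defs.
From mathcomp Require Import all_boot all_order all_fingroup all_algebra.
From mathcomp Require Import all_solvable all_field all_character.
From mathcomp Require Import boolp ring.
Set Implicit Arguments.
Unset Strict Implicit.
Unset Printing Implicit Defensive.

(** Both lattices are spanned by the differences of a family of integer
    vectors, so each has a basis [v k - v j0], for k in a set [A] of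
    representatives of the distinct vectors other than [v j0], as soon as these
    differences are independent over the rationals. Its rank modulo p then
    drops exactly when the same differences become dependent modulo p
    ([conductor_differences]), and it remains to solve one linear system over
    an arbitrary field F. In each case the system has a nonzero solution if
    and only if one prime n vanishes in F.

    Let R be the rotation subgroup of the dihedral group of order 2q; a
    reflection inverts every element of R.

    Commuting matrix: the row of 1 is the all-one vector, the rows of the
    nontrivial rotations all equal the indicator of R, and, as q is odd, the
    row of a reflection s is the indicator of {1, s}. Take as base the row of a
    nontrivial rotation. The coordinate of a relation at a reflection s gives
    c 1 + c s = 0, and the coordinate at a nontrivial rotation says that the
    c s add up to 0 over the q reflections. So q * c 1 = 0, which is the only
    constraint: n = q.

    Characters: the irreducible characters are the trivial one, the sign
    character with kernel R, and nonlinear ones, which vanish off R. The orbit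
    trace of a nonlinear one is constant on the nontrivial rotations, by Galois
    conjugation of roots of unity of order q; orthogonality to the trivial
    character and the value of the norm then force it to be (q - 1, -1, 0) at
    the identity, the nontrivial rotations and the reflections
    ([orbit_trace_nonlinear]). In particular all nonlinear characters have the
    same orbit trace. With the trivial character as base, the differences are
    (0, 0, -2) and (q - 2, -2, -1), which are independent over F exactly when 2
    is nonzero in F: n = 2. *)

(** * Ranks of difference lattices *)

Section LatticeRank.
Import GRing.Theory.
Local Open Scope ring_scope.

(** Freeness of a family indexed by a finite set, with coefficients indexed by
    the set itself instead of by positions in its enumeration. *)
Lemma free_enumP (F : fieldType) (vT : vectType F) (K : finType)
    (A : {set K}) (f : K -> vT) :
  free [seq f k | k in A] <->
  forall c : K -> F, \sum_(k in A) c k *: f k = 0 -> {in A, forall k, c k = 0}.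
Proof.
have sumE c : \sum_(k in A) c k *: f k =
    \sum_(i < #|A|) c (enum_val i) *: [seq f k | k in A]`_i.
  by rewrite big_enum_val; apply: eq_bigr => i _; rewrite nth_image.
split=> [/(@freeP _ _ _ (image_tuple f A)) frA c | indA].
  rewrite sumE => /frA c0 k Ak; rewrite -(enum_rankK_in Ak Ak); exact: c0.
apply/(@freeP _ _ _ (image_tuple f A)) => c sum0 i.
(* Transport coefficients along [enum_val]; the default 0 is never used. *)
pose c' k := if [pick j | enum_val j == k] is Some j then c j else 0.
have c'E j : c' (enum_val j) = c j.
  rewrite /c'; case: pickP => [l /eqP/enum_val_inj-> // | /(_ j)].
  by rewrite eqxx.
rewrite -c'E; apply: indA (enum_valP i); rewrite sumE -[RHS]sum0.
by apply: eq_bigr => j _; rewrite c'E.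
Qed.

Variable I : finType.
Implicit Types (J : finType) (F : fieldType).

Lemma ffun_redB F (x y : {ffun I -> int}) :
  ffun_red F (x - y) = ffun_red F x - ffun_red F y.
Proof. by apply/ffunP=> i; rewrite !ffunE rmorphB. Qed.

Lemma ffun_red_comb F J (v : J -> {ffun I -> int}) (a : J -> int) :
  ffun_red F (\sum_j v j *~ a j) = \sum_j (a j)%:~R *: ffun_red F (v j).
Proof.
apply/ffunP=> i; rewrite !ffunE !sum_ffunE rmorph_sum /=.
apply: eq_bigr => j _; rewrite !ffunE ffunMzE raddfMz /=.
exact/esym/mulrzl.
Qed.

Lemma zspan_gen J (v : J -> {ffun I -> int}) j : zspan v (v j).
Proof.
exists (fun k => (k == j)%:R).
by rewrite (bigD1 j) //= eqxx mulr1z big1 ?addr0 // => k /negPf->.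
Qed.

Lemma lattice_rank_le F J (v : J -> {ffun I -> int})
    (U : {vspace {ffun I -> F^o}}) :
  (forall j, ffun_red F (v j) \in U) -> (lattice_rank F (zspan v) <= \dim U)%N.
Proof.
move=> vU; apply/bigmax_leqP=> r /asboolP[s [sM frs]].
rewrite -(size_tuple s) -(size_map (ffun_red F)).
move: frs; rewrite /free => /eqP <-.
apply: dimvS; apply/span_subvP=> _ /mapP[_ /sM[a ->] ->].
by rewrite ffun_red_comb; apply: memv_suml => j _; apply: memvZ.
Qed.

Lemma lattice_rank_ge F J (v : J -> {ffun I -> int})
    (s : seq {ffun I -> int}) :
  {in s, forall x, zspan v x} -> free (map (ffun_red F) s) ->
  (size s <= lattice_rank F (zspan v))%N.
Proof.
move=> sM frs.
have le_sI: (size s < #|I|.+1)%N.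
  rewrite ltnS -(size_map (ffun_red F)).
  move: (frs); rewrite /free => /eqP <-.
  apply: leq_trans (dimvS (subvf _)) _; rewrite dimvf.
  by rewrite /dim /= muln1.
rewrite /lattice_rank.
apply: (@leq_trans (Ordinal le_sI)) => //.
apply: leq_bigmax_cond; apply/asboolP.
by exists (in_tuple s).
Qed.

(** The rank over F is at most the dimension of the span of the reduced
    differences [v k - v j0], hence at most #|A|, and it equals #|A| when they
    are independent. Stating independence over an arbitrary field, controlled
    by whether n vanishes there, settles the rational rank and the rank modulo
    every prime at once. *)
Lemma conductor_differences J (v : J -> {ffun I -> int})
    (j0 : J) (A : {set J}) (n : nat) :
  prime n ->
  (forall j, v j = v j0 \/ exists2 k, k \in A & v j = v k) ->
  (forall F : fieldType, n%:R != 0 :> F -> forall c : J -> F,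
     (forall i, \sum_(k in A) c k * (v k i - v j0 i)%:~R = 0) ->
     {in A, forall k, c k = 0}) ->
  (forall F : fieldType, n%:R = 0 :> F -> exists2 c : J -> F,
     forall i, \sum_(k in A) c k * (v k i - v j0 i)%:~R = 0 &
     exists2 k, k \in A & c k != 0) ->
  conductor (zspan (fun jj : J * J => v jj.1 - v jj.2)) =i (n : nat_pred).
Proof.
move=> n_pr genA indA depA p; set M := zspan _.
pose w F (k : J) : {ffun I -> F^o} := ffun_red F (v k - v j0).
have relE (F : fieldType) (c : J -> F) : \sum_(k in A) c k *: w F k = 0 <->
    forall i, \sum_(k in A) c k * (v k i - v j0 i)%:~R = 0.
  have entry i : (\sum_(k in A) c k *: w F k) i =
      \sum_(k in A) c k * (v k i - v j0 i)%:~R.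
    by rewrite sum_ffunE; apply: eq_bigr => k _; rewrite !ffunE.
  split=> [c0 i | c0]; first by rewrite -entry c0 ffunE.
  by apply/ffunP=> i; rewrite entry c0 ffunE.
have rank_ub F : (lattice_rank F M <= \dim <<[seq w F k | k in A]>>)%N.
  apply: lattice_rank_le => -[j1 j2] /=.
  have memw j : w F j \in <<[seq w F k | k in A]>>%VS.
    case: (genA j) => [|[k Ak]] vj; rewrite /w vj; last first.
      by apply: memv_span; apply: image_f.
    by rewrite ffun_redB subrr mem0v.
  rewrite (_ : v j1 - v j2 = (v j1 - v j0) - (v j2 - v j0)).
    by rewrite ffun_redB memvB ?memw.
  by rewrite opprB addrA subrK.
have free_rank F : n%:R != 0 :> F -> (#|A| <= lattice_rank F M)%N.
  move=> nF.
  have -> : #|A| = size [seq v k - v j0 | k in A] by rewrite size_image.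
  apply: lattice_rank_ge => [x /mapP[k _ ->] | ].
    exact: (zspan_gen (fun jj : J * J => v jj.1 - v jj.2) (k, j0)).
  rewrite /image_mem -map_comp; apply/(free_enumP A (w F)) => c /relE.
  exact: indA.
have rank_ub' F : (lattice_rank F M <= #|A|)%N.
  apply: leq_trans (rank_ub F) (leq_trans (dim_span _) _).
  by rewrite size_image.
have free_rat : (#|A| <= lattice_rank rat M)%N.
  by apply: free_rank; rewrite Num.Theory.pnatr_eq0 -lt0n prime_gt0.
rewrite !inE; apply/andP/eqP=> [[p_pr lt_p] | ->].
  apply/eqP; apply: contraTT lt_p => neq_pn; rewrite -leqNgt.
  apply: leq_trans (rank_ub' _) (free_rank _ _).
  by rewrite -(dvdn_pcharf (pchar_Fp p_pr)) dvdn_prime2.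
split=> //; apply: leq_trans free_rat.
apply: leq_ltn_trans (rank_ub _) _.
rewrite ltn_neqAle -[X in (_ <= X)%N](size_image (w 'F_n) A) dim_span andbT.
rewrite -(size_image (w 'F_n) A).
have [|c /relE c0 [k Ak nz_ck]] := depA 'F_n.
  by apply/eqP; rewrite -(dvdn_pcharf (pchar_Fp n_pr)).
apply: contraNneq nz_ck => dimA.
have /(free_enumP A (w 'F_n))/(_ c c0)-> // : free [seq w 'F_n k | k in A].
by rewrite /free dimA.
Qed.

End LatticeRank.

(** * Structure of the dihedral group *)

Section DihedralStructure.
Import GroupScope.

(** The rotation subgroup is generated by the first generator x of the
    presentation. That x has order exactly q, not a proper divisor, comes from
    the order of the group: 2q = #|<[x]> * <[y]>| <= #[x] * 2. *)
Lemma dihedral_rotations (q : nat) (gT : finGroupType) (G : {group gT}) :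
    1 < q -> G \isog 'D_(2 * q) ->
  exists R : {group gT},
    [/\ R \subset G, #|R| = q, #|G| = (2 * q)%N &
        {in R & G :\: R, forall h g, h ^ g = h^-1}].
Proof.
move=> q_gt1; rewrite mul2n => /(isoGrpP _ (Grp_dihedral q_gt1)) [].
rewrite card_dihedral // => oG /existsP[[x y] /= /eqP[defG xq y2 xy]].
have{} defG: <[x]> * <[y]> = G.
  by rewrite -norm_joinEr // norms_cycle xy groupV cycle_id.
have ox_le : #[x] <= q by rewrite dvdn_leq ?(ltnW q_gt1) // order_dvdn xq.
have oy_le : #[y] <= 2 by rewrite dvdn_leq // order_dvdn y2.
have ox : #[x] = q.
  apply/eqP; rewrite eqn_leq ox_le -leq_double -[X in _ <= X]muln2 -oG -defG.
  apply: leq_trans (leq_mul (leqnn _) oy_le).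
  by rewrite dvdn_leq ?dvdn_cardMg // muln_gt0 !order_gt0.
exists <[x]>%G; split=> // [|h g Rh /setDP[Gg R'g]].
  by rewrite -defG mulG_subl.
have: g \in <[x]> * <[y]> by rewrite defG.
case/mulsgP=> a b Ra /cycleP[k ->] def_g.
have yk : y ^+ k = y ^+ odd k.
  by rewrite -{1}(odd_double_half k) expgD -mul2n expgM y2 expg1n mulg1.
rewrite def_g yk in R'g *.
case: (odd k) R'g => [_ | ]; last by rewrite mulg1 Ra.
have xyV n : (x ^+ n) ^ y = (x ^+ n)^-1 by rewrite conjXg xy expgVn.
case/cycleP: Rh => m ->; case/cycleP: Ra => l ->.
rewrite conjgM (_ : (x ^+ m) ^ (x ^+ l) = x ^+ m) ?xyV //.
by rewrite conjgE -!expgD addnC expgD mulKg.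
Qed.

End DihedralStructure.

(** The rest uses only that R is a subgroup of index 2 and odd prime order
    whose elements are inverted by those outside R. *)
Section Dihedral.
Import GroupScope.

Variables (gT : finGroupType) (G R : {group gT}) (q : nat).
Hypotheses (q_pr : prime q) (q_odd : odd q) (sRG : R \subset G).
Hypotheses (oR : #|R| = q) (oG : #|G| = (2 * q)%N).
Hypothesis conjR : {in R & G :\: R, forall h g, h ^ g = h^-1}.

Lemma card_reflections : #|G :\: R| = q.
Proof. by rewrite cardsD (setIidPr sRG) oG oR mul2n -addnn addnK. Qed.

Lemma index_rotations : #|G : R| = 2.
Proof. by rewrite -divgS // oG oR mulnK // prime_gt0. Qed.

Lemma normal_rotations : R <| G.
Proof. exact: index2_normal sRG index_rotations. Qed.

Lemma abelian_rotations : abelian R.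
Proof. by rewrite cyclic_abelian // prime_cyclic // oR. Qed.

Lemma rotation_exists : exists x, x \in R^#.
Proof.
have /trivgPn[x Rx nt_x] : R :!=: 1 by rewrite -cardG_gt1 oR prime_gt1.
by exists x; rewrite !inE nt_x.
Qed.

Lemma reflection_exists : exists s, s \in G :\: R.
Proof. by apply/set0Pn; rewrite -card_gt0 card_reflections prime_gt0. Qed.

Lemma rotation_cycle x : x \in R^# -> <[x]> = R.
Proof.
case/setD1P=> nt_x Rx; apply/eqP; rewrite eqEcard cycle_subG Rx oR.
have: #[x] %| q by rewrite -oR order_dvdG.
case/primeP: q_pr => _ /[apply]; rewrite order_eq1 (negPf nt_x) /=.
by move/eqP=> <-; rewrite leqnn.
Qed.

Lemma rotation_eqV x : x \in R -> x^-1 = x -> x = 1.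
Proof.
move=> Rx Vx; apply/eqP; rewrite -order_eq1 -dvdn1.
have o2: #[x] %| 2 by rewrite order_dvdn expgS expg1 -{2}Vx mulgV.
have oq: #[x] %| q by rewrite -oR order_dvdG.
by have := dvdn_gcd #[x] 2 q; rewrite o2 oq (eqP (_ : coprime 2 q)) ?coprime2n.
Qed.

Lemma reflection_quotient s t :
  s \in G :\: R -> t \in G :\: R -> t * s^-1 \in R.
Proof.
move=> /setDP[Gs R's] Gt; rewrite -mem_rcoset.
have /setP/(_ t) : R :* s = G :\: R.
  apply/eqP; rewrite eqEcard card_rcoset oR card_reflections leqnn andbT.
  apply/subsetP=> _ /rcosetP[r Rr ->]; rewrite !inE (groupMl _ Rr) R's.
  by rewrite groupM // (subsetP sRG).
by rewrite Gt.
Qed.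

Lemma commute_rotation x h : x \in R^# -> h \in G ->
  (x * h == h * x) = (h \in R).
Proof.
move=> R1x Gh; have [nt_x Rx] := setD1P R1x.
have [Rh | R'h] := boolP (h \in R).
  by apply/eqP; apply: (centsP abelian_rotations).
apply: contraNF nt_x => /eqP/commgP/conjg_fixP.
by rewrite conjR // ?inE ?R'h // => /(rotation_eqV Rx)->.
Qed.

Lemma commute_reflection s h : s \in G :\: R -> h \in G ->
  (s * h == h * s) = (h == 1) || (h == s).
Proof.
move=> R's Gh; apply/eqP/orP=> [sh|[] /eqP->]; rewrite ?mulg1 ?mul1g //.
have [Rh|R'h] := boolP (h \in R).
  left; apply/eqP/rotation_eqV => //.
  by rewrite -(conjR Rh R's) conjgE -sh mulKg.
have Rr: h * s^-1 \in R by rewrite reflection_quotient // inE R'h.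
right; rewrite eq_mulgV1; apply/eqP/rotation_eqV => //.
by rewrite -(conjR Rr R's) conjgE mulgKV; apply: (mulgI s);
  rewrite mulKVg mulgA sh mulgK.
Qed.

(** * The commuting conductor *)

Section CommutingConductor.
Import GRing.Theory.
Local Open Scope ring_scope.

Lemma commuting_rowE (g h : subg_of G) :
  commuting_row g h = (sgval g * sgval h == sgval h * sgval g)%g%:R.
Proof. by rewrite ffunE -val_eqE. Qed.

Lemma commuting_row1 (h : subg_of G) : commuting_row 1%g h = 1.
Proof. by rewrite ffunE mul1g mulg1 eqxx. Qed.

Lemma commuting_row_rotation (x h : subg_of G) : sgval x \in R^#%g ->
  commuting_row x h = (sgval h \in R)%:R.
Proof. by move=> R1x; rewrite commuting_rowE commute_rotation ?subgP. Qed.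

Lemma commuting_row_reflection (s h : subg_of G) : sgval s \notin R ->
  commuting_row s h = ((h == 1%g) || (h == s))%:R.
Proof.
by move=> R's; rewrite commuting_rowE commute_reflection ?inE ?R's ?subgP.
Qed.

Lemma card_subg_reflections : #|[set s : subg_of G | sgval s \notin R]| = q.
Proof.
rewrite -card_reflections -(card_imset _ val_inj).
apply: eq_card => g; apply/imsetP/setDP=> [[s /[!inE] R's ->]|[Gg R'g]].
  by rewrite subgP.
by exists (subg G g); rewrite ?inE /= subgK.
Qed.

(** The linear system attached to the commuting matrix, with base row that of
    a nontrivial rotation x, and with the identity and the reflections as
    representatives of the other rows. *)
Lemma commuting_relationE (F : fieldType) (c : subg_of G -> F)
    (x i : subg_of G) : sgval x \in R^#%g ->
  \sum_(k in 1%g |: [set s | sgval s \notin R])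
     c k * (commuting_row k i - commuting_row x i)%:~R =
  if i == 1%g then 0 else
  if sgval i \in R then - \sum_(s | sgval s \notin R) c s else c 1%g + c i.
Proof.
move=> R1x; rewrite big_setU1 ?inE ?group1 //= !(commuting_row_rotation _ R1x).
rewrite commuting_row1.
rewrite (eq_bigl (fun s => sgval s \notin R)) => [|s]; last by rewrite inE.
under eq_bigr => s R's do rewrite commuting_row_reflection //.
have [-> | nt_i] := eqVneq i 1%g.
  rewrite group1 subrr mulr0 add0r big1 // => s _.
  by rewrite mulr0.
have [Ri | R'i] := boolP (sgval i \in R).
  rewrite subrr mulr0 add0r -sumrN; apply: eq_bigr => s R's.
  rewrite (_ : i == s = false) ?mulrN1 //.
  by apply: contraNF R's => /eqP<-.
rewrite subr0 mulr1 (bigD1 i) //= eqxx subr0 mulr1 big1 ?addr0 // => s.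
by case/andP=> _ /negPf; rewrite eq_sym => ->; rewrite subrr mulr0.
Qed.

Lemma commuting_conductor_dihedral :
  commuting_conductor G =i (q : nat_pred).
Proof.
have [x R1x] : exists x : subg_of G, sgval x \in R^#%g.
  have [x R1x] := rotation_exists; have [_ Rx] := setD1P R1x.
  by exists (subg G x); rewrite subgK ?(subsetP sRG).
set A := 1%g |: [set s : subg_of G | sgval s \notin R].
have sum1 (F : fieldType) (a : F) :
    \sum_(s : subg_of G | sgval s \notin R) a = a *+ q.
  rewrite sumr_const -card_subg_reflections; congr (_ *+ _).
  by apply: eq_card => s; rewrite inE.
have nt_x : x != 1%g by case/setD1P: R1x.
have Rx : sgval x \in R by case/setD1P: R1x.
have nt_R' (s : subg_of G) : sgval s \notin R -> s != 1%g.
  by apply: contraNneq => ->; apply: group1.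
apply: (conductor_differences (j0 := x) (A := A)) =>
  // [g | F nz_q c c0 | F q0].
- have [R'g | ] := boolP (g \in A); first by right; exists g.
  rewrite !inE negb_or negbK => /andP[nt_g Rg]; left.
  by apply/ffunP=> h; rewrite !commuting_row_rotation // !inE ?nt_g.
- have cs s : sgval s \notin R -> c s = - c 1%g.
    move=> R's; have := c0 s; rewrite commuting_relationE //.
    rewrite (negPf (nt_R' s R's)) (negPf R's) addrC => /eqP.
    by rewrite addr_eq0 => /eqP.
  have c1 : c 1%g = 0.
    have := c0 x; rewrite commuting_relationE // (negPf nt_x) Rx.
    rewrite (eq_bigr _ cs) sum1 mulNrn opprK -mulr_natr => /eqP.
    by rewrite mulf_eq0 (negPf nz_q) orbF => /eqP.
  by move=> s /[!inE] /predU1P[-> // | /cs->]; rewrite c1 oppr0.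
- exists (fun s => if s == 1%g then 1 else -1) => [i | ]; last first.
    by exists 1%g; rewrite ?setU11 // eqxx oner_neq0.
  rewrite commuting_relationE // eqxx.
  have [// | nt_i] := eqVneq i 1%g; case: ifP => _; last by rewrite subrr.
  rewrite (eq_bigr (fun => -1)) => [|s /nt_R'/negPf-> //].
  by rewrite sum1 -mulNrn opprK.
Qed.

End CommutingConductor.

(** * Irreducible characters and orbit traces *)

Section CharacterConductor.
Import GroupScope Order.TTheory GRing.Theory Num.Theory.
Local Open Scope ring_scope.

Let nRG := normal_rotations.

Lemma sign_classfun_val g : g \in G ->
  (2%:R *: '1_R - 1 : 'CF(G)) g = if g \in R then 1 else -1.
Proof.
move=> Gg; rewrite !cfunE cfun1E cfuniE // Gg; case: (g \in R).
  by rewrite mulr1 addrK.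
by rewrite mulr0 add0r.
Qed.

(** Up to sign an irreducible character, being a virtual character of norm 1:
    twice the indicator of R is induced from the trivial character of R. The
    sign is positive by the value at 1. *)
Lemma sign_irr : 2%:R *: '1_R - 1 \in irr G.
Proof.
set eps := _ - _; have epsE := sign_classfun_val; rewrite -/eps in epsE.
have Zeps : eps \in 'Z[irr G].
  rewrite rpredB ?cfun1_vchar // -index_rotations -cfInd_cfun1 //.
  by rewrite char_vchar // cfInd_char // rpred1.
have norm_eps : '[eps] = 1.
  rewrite cfdotE (eq_bigr (fun => 1)) => [|g Gg].
    by rewrite sumr_const mulVf // neq0CG.
  by rewrite epsE //; case: ifP; rewrite ?rmorphN rmorph1 ?mulrNN mulr1.
have [b [i def_eps]] := vchar_norm1P Zeps norm_eps.
have := irr1_gt0 i; have := epsE 1%g (group1 G).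
rewrite def_eps cfunE group1; case: b {def_eps} => [|_ _]; last first.
  by rewrite expr0 scale1r mem_irr.
by rewrite mulN1r => /eqP; rewrite eqr_oppLR => /eqP->; rewrite oppr_gt0 ltr10.
Qed.

Let sgn : Iirr G := cfIirr (2%:R *: '1_R - 1).

Lemma sign_charE : 'chi_sgn = 2%:R *: '1_R - 1.
Proof. exact: cfIirrE sign_irr. Qed.

Lemma sign_char_val g : g \in G -> 'chi_sgn g = if g \in R then 1 else -1.
Proof. by rewrite sign_charE; apply: sign_classfun_val. Qed.

Lemma reflection_centralizer s : s \in G :\: R -> #|'C_G[s]| = 2%N.
Proof.
move=> R's; have [Gs R's'] := setDP R's.
have -> : 'C_G[s] = [set 1%g; s].
  apply/setP=> h; rewrite in_setI in_set2; have [Gh|G'h] := boolP (h \in G).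
    by rewrite -commute_reflection //; apply/cent1P/eqP.
  by apply/esym/norP; split; apply: contraNneq G'h => ->; rewrite ?group1.
by rewrite cards2 eq_sym; case: eqP R's' => // ->; rewrite group1.
Qed.

(** By column orthogonality the squared moduli of the values at s add up to
    the order 2 of its centralizer, and the trivial and sign characters
    already contribute 1 each. *)
Lemma irr_reflection i s :
  i != 0 -> i != sgn -> s \in G :\: R -> 'chi_i s = 0.
Proof.
move=> nz_i ne_i R's; have [Gs R's'] := setDP R's.
have := second_orthogonality_relation s Gs.
rewrite reflection_centralizer // class_refl mulr1n.
have ne_e : sgn != 0.
  apply: contraNneq R's' => e0; have := sign_char_val Gs.
  rewrite e0 irr0 cfun1E Gs; case: ifP => // _ /eqP.
  by rewrite -subr_eq0 opprK -(natrD _ 1 1) pnatr_eq0.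
rewrite (bigD1 0) //= (bigD1 sgn) //= irr0 cfun1E Gs sign_char_val //.
rewrite (negPf R's') rmorphN !rmorph1 mulrNN !mulr1 addrA.
rewrite -(natrD _ 1 1) -[X in _ = X]addr0 => /addrI sum0.
have /psumr_eq0P/(_ sum0 i) :
    forall j, (j != 0) && (j != sgn) -> 0 <= 'chi_j s * ('chi_j s)^*.
  by move=> j _; apply: mul_conjC_ge0.
by rewrite nz_i ne_i => /(_ isT)/eqP; rewrite mul_conjC_eq0 => /eqP.
Qed.

(** Here y is a power x ^ k with k prime to q, and some automorphism of the
    algebraic numbers raises q-th roots of unity to the power k. It maps
    the value at x to the value at y of every linear character of R, hence of
    every sum of such characters. *)
Lemma rotation_conjugate x y : x \in R^#%g -> y \in R^#%g ->
  exists u : {rmorphism algC -> algC},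
    forall chi : 'CF(G), chi \is a character -> chi y = u (chi x).
Proof.
move=> R1x R1y; have [nt_x Rx] := setD1P R1x; have [nt_y Ry] := setD1P R1y.
have /cycleP[k def_y] : y \in <[x]> by rewrite rotation_cycle.
have xq : (x ^+ q = 1)%g by rewrite -oR expg_cardG.
have co_kq : coprime k q.
  rewrite coprime_sym prime_coprime //; apply: contra nt_y.
  by case/dvdnP=> m def_k; rewrite def_y def_k mulnC expgM xq expg1n.
have [u def_u] := Qn_aut_exists co_kq; exists u => chi Nchi.
have [r def_r] := char_sum_irr (cfRes_char R Nchi).
rewrite -!(cfResE chi sRG) // def_r !sum_cfunE rmorph_sum.
apply: eq_bigr => j _.
have lin_j : 'chi_j \is a linear_char.
  exact: (char_abelianP _ abelian_rotations).
by rewrite def_y lin_charX // def_u // -lin_charX // xq lin_char1.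
Qed.

Lemma orbit_trace_rotation (i : Iirr G) x y : x \in R^#%g -> y \in R^#%g ->
  orbit_trace i x = orbit_trace i y.
Proof.
move=> R1x R1y; have [u conj_u] := rotation_conjugate R1x R1y.
rewrite [RHS]conj_u; last by apply: rpred_sum => j _; apply: irr_char.
by rewrite -[in LHS](cfAut_orbit_trace u) cfunE.
Qed.

Lemma orbit_trace_fixed i : (forall u : {rmorphism algC -> algC},
  cfAut u 'chi[G]_i = 'chi_i) -> orbit_trace i = 'chi_i.
Proof.
move=> fix_i; rewrite /orbit_trace (big_pred1 i) // => j.
rewrite inE; apply/asboolP/eqP=> [[u] | ->]; last by exists idfun.
by rewrite fix_i => /irr_inj.
Qed.

Lemma orbit_trace0 : orbit_trace (0 : Iirr G) = 1.
Proof. by rewrite orbit_trace_fixed ?irr0 // => u; rewrite cfAut_cfun1. Qed.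

Lemma orbit_trace_sign : orbit_trace sgn = 'chi_sgn.
Proof.
apply: orbit_trace_fixed => u; rewrite sign_charE.
by rewrite rmorphB /= cfAutZ_nat cfAut_cfun1i cfAut_cfun1.
Qed.

Lemma cfdot_rotations (phi psi : 'CF(G)) x :
    {in G :\: R, forall s, phi s = 0} ->
    {in R^#%g, forall y, phi y = phi x /\ psi y = psi x} ->
  '[phi, psi] = (2 * q)%:R^-1 *
     (phi 1%g * (psi 1%g)^* + (phi x * (psi x)^*) *+ q.-1).
Proof.
move=> phi0 const; rewrite cfdotE oG; congr (_ * _).
rewrite (big_setID R) /= [X in _ + X]big1 ?addr0 => [|s /phi0->]; last first.
  by rewrite mul0r.
rewrite (setIidPr sRG) (big_setD1 1%g) //=; congr (_ + _).
rewrite (eq_bigr (fun => phi x * (psi x)^*)) => [|y /const[-> ->] //].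
by rewrite sumr_const -oR (cardsD1 1%g R) group1.
Qed.

(** Let T be the orbit trace of a nonlinear character of degree d, m the size
    of its orbit and z the integer value of T on the nontrivial rotations. As
    T 1 = m d, orthogonality to the trivial character gives
    m d + (q - 1) z = 0, and the norm of T being m gives
    (m d)^2 + (q - 1) z^2 = 2 q m. Eliminating, z d = -2; since d > 1 this
    forces d = 2 and z = -1, without listing the characters of degree 2. *)
Lemma orbit_trace_nonlinear i : i != 0 -> i != sgn ->
  {in G, forall g, orbit_trace i g =
     if g == 1%g then q.-1%:R else if g \in R then -1 else 0}.
Proof.
move=> nz_i ne_i; set T := orbit_trace i; set O := galois_orbit i.
have orbP j : j \in O ->
    exists u : {rmorphism algC -> algC}, 'chi_j = cfAut u 'chi_i.
  by rewrite inE => /asboolP.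
have [x R1x] := rotation_exists; have [s R's] := reflection_exists.
have [Gs _] := setDP R's.
have chis0 j : j \in O -> {in G :\: R, forall t, 'chi_j t = 0}.
  by case/orbP=> u -> t R't; rewrite cfunE irr_reflection ?rmorph0.
have T0 : {in G :\: R, forall t, T t = 0}.
  by move=> t R't; rewrite sum_cfunE big1 // => j /chis0->.
have Tconst : {in R^#%g, forall y, T y = T x}.
  by move=> y R1y; apply: orbit_trace_rotation.
have normT : '[T] = #|O|%:R.
  rewrite cfdot_suml -sumr_const; apply: eq_bigr => j Oj.
  rewrite cfdot_sumr (bigD1 j) //= cfdot_irr eqxx big1 ?addr0 // => k.
  by case/andP=> _ /negPf; rewrite cfdot_irr eq_sym => ->.
have T_triv : '[T, 1] = 0.
  rewrite cfdot_suml big1 // => j Oj; rewrite -irr0 cfdot_irr.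
  case: eqP => // j0; have /eqP := chis0 j Oj s R's.
  by rewrite j0 irr0 cfun1E Gs oner_eq0.
have [d def_d] := natrP (Cnat_irr1 i).
have T1 : T 1%g = (#|O| * d)%:R.
  rewrite sum_cfunE mulnC natrM mulr_natr -sumr_const.
  by apply: eq_bigr => j /orbP[u ->]; rewrite cfunE def_d rmorph_nat.
have m_gt0 : (0 < #|O|)%N.
  apply/card_gt0P; exists i; rewrite inE; apply/asboolP; exists idfun.
  by apply/cfunP=> g; rewrite !cfunE.
(* A linear character has no zeros, but this one vanishes at s. *)
have d_neq1 : d != 1%N.
  apply/eqP=> d1; have lin_i : 'chi_i \is a linear_char.
    by rewrite qualifE /= irr_char def_d d1 eqxx.
  by have := lin_char_neq0 lin_i Gs; rewrite irr_reflection ?eqxx.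
have [z def_z] := intrP (orbit_trace_int i x).
have def_q : q = q.-1.+1 by rewrite prednK ?prime_gt0.
have q_neq0 : (2 * q)%:R != 0 :> algC.
  by rewrite pnatr_eq0 -lt0n muln_gt0 (prime_gt0 q_pr).
have eq_triv : (#|O| * d)%:R + z%:~R * q.-1%:R = 0 :> algC.
  have := T_triv; rewrite (cfdot_rotations (x := x)) // => [|y R1y]; last first.
    have [/[!inE]/andP[nt_y Ry] _] := (R1y, R1x).
    by rewrite Tconst // !cfun1E !(subsetP sRG) //; case/setD1P: R1x.
  have Gx : x \in G by case/setD1P: R1x => _ /(subsetP sRG).
  rewrite T1 !cfun1E group1 Gx rmorph1 !mulr1 -/T def_z mulr_natr => /eqP.
  by rewrite mulf_eq0 invr_eq0 (negPf q_neq0) => /eqP.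
have eq_norm : (#|O| * d)%:R ^+ 2 + z%:~R ^+ 2 * q.-1%:R =
    (2 * q)%:R * #|O|%:R :> algC.
  rewrite -normT (cfdot_rotations (x := x)) // => [|y R1y]; last first.
    by rewrite Tconst.
  by rewrite T1 -/T def_z rmorph_nat rmorph_int mulVKf // mulr_natr.
have zd : z * d%:Z = - 2.
  have nz_m : #|O|%:R != 0 :> algC by rewrite pnatr_eq0 -lt0n.
  apply: (intr_inj (R := algC)); apply: (mulfI nz_m); apply: (mulfI q_neq0).
  have def_qC : q%:R = q.-1%:R + 1 :> algC by rewrite {1}def_q mulrSr.
  move: eq_triv eq_norm.
  rewrite intrM mulrNz !natrM def_qC -!pmulrn.
  move: #|O|%:R d%:R z%:~R q.-1%:R => m D Z Q sum0 normE.
  (* This combination of both equations cancels the squares of m D and Z Q. *)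
  rewrite (_ : _ * _ = 2 * (Q + 1) * Z * (m * D + Z * Q)
     + 2 * (m * D - Z * Q) * (m * D + Z * Q)
     - 2 * ((m * D) ^+ 2 + Z ^+ 2 * Q)); last by ring.
  by rewrite sum0 normE; ring.
have [d2 z1] : d = 2%N /\ z = -1.
  have : (d %| 2)%N.
    by have /(congr1 absz) := zd; rewrite abszM /= => <-; rewrite dvdn_mull.
  case/primeP: (isT : prime 2) => _ /[apply]; rewrite (negPf d_neq1) => /eqP d2.
  by split=> //; apply: (@mulIf _ 2%:Z); rewrite // mulN1r; rewrite d2 in zd.
move=> g Gg; case: eqP => [-> | /eqP nt_g].
  by move/eqP: eq_triv; rewrite z1 mulN1r subr_eq0 -T1 => /eqP.
case: ifP => Rg; last by rewrite T0 // !inE Rg.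
by rewrite Tconst ?inE ?nt_g // /T def_z z1.
Qed.

(** Otherwise G would be abelian and its reflections central, but their
    centralizers have order 2. *)
Lemma exists_nonlinear : exists2 i : Iirr G, i != 0 & i != sgn.
Proof.
have [/existsP[i /andP[nz_i ne_i]] | ] :=
  boolP [exists i, (i != 0) && (i != sgn)].
  by exists i.
rewrite negb_exists => /forallP only_lin.
have chi1 (i : Iirr G) : 'chi_i 1%g = 1.
  have := only_lin i; rewrite negb_and !negbK => /orP[] /eqP->.
    by rewrite irr0 cfun1E group1.
  by rewrite sign_char_val ?group1.
have ab : abelian G.
  by apply/char_abelianP => i; rewrite qualifE /= irr_char chi1 eqxx.
have [s R's] := reflection_exists.
have [Gs _] := setDP R's.
have := reflection_centralizer R's.
rewrite (setIidPl _); last by rewrite sub_cent1 (subsetP ab).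
move/eqP; rewrite oG -[X in _ == X]muln1 eqn_pmul2l // => /eqP q1.
by have := q_pr; rewrite q1.
Qed.

(** * The character conductor *)

Lemma orbit_trace_vecE (i : Iirr G) (z : int) c :
  orbit_trace i (repr (val c)) = z%:~R -> orbit_trace_vec i c = z.
Proof. by move=> Tz; rewrite ffunE Tz intrKfloor. Qed.

Lemma class_eval g : g \in G ->
  exists c : {c : {set gT} | c \in classes G},
    forall phi : 'CF(G), phi (repr (val c)) = phi g.
Proof.
move=> Gg; have clg : g ^: G \in classes G by apply: mem_classes.
by exists (Sub (g ^: G) clg) => phi; rewrite /= cfun_repr.
Qed.

(** A nonlinear t represents all nonlinear characters, so the sign character
    and t suffice. The classes of a nontrivial rotation and of a reflection
    already give a triangular system with 2 on the diagonal, up to sign; modulo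
    2 the sign and trivial characters coincide. *)
Lemma character_conductor_dihedral : character_conductor G =i (2%N : nat_pred).
Proof.
have [t nz_t ne_t] := exists_nonlinear.
have [x R1x] := rotation_exists.
have [nt_x Rx] := setD1P R1x; have Gx := subsetP sRG x Rx.
have [s R's] := reflection_exists.
have [Gs R's'] := setDP R's.
have sumA (F : fieldType) (f : Iirr G -> F) :
    \sum_(k in [set sgn; t]) f k = f sgn + f t.
  by rewrite big_setU1 ?big_set1 // inE eq_sym.
have [cx cxE] := class_eval Gx; have [cs csE] := class_eval Gs.
apply: (conductor_differences (j0 := 0) (A := [set sgn; t])) =>
  // [i | F nz2 c c0 | F F2].
- have [-> | nz_i] := eqVneq i 0; first by left.
  right; have [-> | ne_i] := eqVneq i sgn; first by exists sgn; rewrite ?set21.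
  exists t; first exact: set22.
  apply/ffunP=> -[c clc]; rewrite !ffunE /=.
  have [Gc _] := repr_classesP clc.
  by rewrite !orbit_trace_nonlinear.
- have valx : [/\ orbit_trace_vec 0 cx = 1, orbit_trace_vec sgn cx = 1
                & orbit_trace_vec t cx = -1].
    split; apply: orbit_trace_vecE; rewrite cxE.
    + by rewrite orbit_trace0 cfun1E Gx.
    + by rewrite orbit_trace_sign sign_char_val ?Rx.
    + by rewrite orbit_trace_nonlinear // (negPf nt_x) Rx.
  have vals : [/\ orbit_trace_vec 0 cs = 1, orbit_trace_vec sgn cs = -1
                & orbit_trace_vec t cs = 0].
    have nt_s : s != 1%g by apply: contraNneq R's' => ->; rewrite group1.
    split; apply: orbit_trace_vecE; rewrite csE.
    + by rewrite orbit_trace0 cfun1E Gs.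
    + by rewrite orbit_trace_sign sign_char_val // (negPf R's').
    + by rewrite orbit_trace_nonlinear // (negPf nt_s) (negPf R's').
  have ct : c t = 0.
    have := c0 cx; rewrite sumA; have [-> -> ->] := valx.
    rewrite subrr mulr0 add0r -opprD mulrNz => /eqP.
    by rewrite mulrN oppr_eq0 mulf_eq0 (negPf nz2) orbF => /eqP.
  have ce : c sgn = 0.
    have := c0 cs; rewrite sumA ct mul0r addr0; have [-> -> _] := vals.
    rewrite -opprD mulrNz mulrN => /eqP.
    by rewrite oppr_eq0 mulf_eq0 (negPf nz2) orbF => /eqP.
  by move=> k /set2P[] ->.
- exists (fun k => (k == sgn)%:R) => [c | ]; last first.
    by exists sgn; rewrite ?inE ?eqxx ?oner_neq0.
  rewrite sumA eqxx (negPf ne_t) mul0r addr0 mul1r.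
  have [Gc _] := repr_classesP (valP c).
  rewrite (orbit_trace_vecE (i := 0) (z := 1)); last first.
    by rewrite orbit_trace0 cfun1E Gc.
  rewrite (orbit_trace_vecE (z := if repr (val c) \in R then 1 else -1)).
    by case: ifP => _; rewrite ?subrr // -opprD mulrNz -[_%:~R]/(2%:R) F2 oppr0.
  by rewrite orbit_trace_sign sign_char_val //; case: ifP.
Qed.

End CharacterConductor.

End Dihedral.

(** * The two conductors *)

Theorem theorem9p1 (q : nat) (q_prime : prime q) (q_odd : odd q) :
  character_conductor ('D_(2 * q)%N)%G =i (2 : nat_pred) /\
  commuting_conductor ('D_(2 * q)%N)%G =i (q : nat_pred).
Proof.
have [R [sRG oR oG conjR]] :=
  dihedral_rotations (prime_gt1 q_prime) (isog_refl ('D_(2 * q))%G).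
split.
  exact: (character_conductor_dihedral q_prime q_odd sRG oR oG conjR).
exact: (commuting_conductor_dihedral q_prime q_odd sRG oR oG conjR).
Qed.
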